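(* Let $F$ denote a demand distribution with support $S$ within $L$ and $H$ that is strictly DGMRD and has finite second moment, $r^*$ the respective optimal wholesale price in the stochastic market, such that $H>2r^*$, and $\alpha\in S$, with $\alpha>r^*$, a realized demand level, for which trading between supplier and retailers takes place in both the stochastic and the deterministic market. Let $\Pi_s^U/\Pi^U_{\mathrm{Agg}}$ and $\Pi_s^D/\Pi^D_{\mathrm{Agg}}$ denote the supplier's share of realized profits in the stochastic and deterministic markets, respectively. Then: (i) $\Pi_s^U\le\Pi_s^D$, with equality only for $\alpha=2r^*$. In particular, $\Pi_s^U/\Pi_s^D=4(r^*/\alpha)(1-r^*/\alpha)$ for any $\alpha>r^*$. (ii) $\Pi_s^U/\Pi^U_{\mathrm{Agg}}$ decreases in the realized demand level $\alpha$. (iii) $\Pi_s^D/\Pi^D_{\mathrm{Agg}}$ is independent of the demand level $\alpha$. (iv) $\Pi_s^U/\Pi^U_{\mathrm{Agg}}$ is higher than $\Pi_s^D/\Pi^D_{\mathrm{Agg}}$ for values of $\alpha\in(r^*,2r^* )$, equal for $\alpha=2r^*$, and lower otherwise. (v) $\Pi_s^D/\Pi^D_{\mathrm{Agg}}$ and $\Pi_s^U/\Pi^U_{\mathrm{Agg}}$ both increase in the level $n$ of retail competition. Finally, each retailer's profit in the stochastic market, $\Pi_i^U$, is strictly higher than her profit in the deterministic market, $\Pi_i^D$, for all demand levels $\alpha>2r^*$ and less otherwise, with equality for $\alpha=2r^*$ only.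
   Context: Setting: a supplier sells to $n\ge1$ symmetric retailers engaged in classic Cournot competition with linear demand (slope scaled to 1). Given a wholesale price $r\ge0$ and realized demand level $\alpha$, each retailer orders $q_i^*(r)=\frac{1}{n+1}(\alpha-r)_+$ in equilibrium, where $(x)_+=\max\{0,x\}$. In the stochastic market (superscript $U$) the supplier only knows the demand distribution $F$; in the deterministic market (superscript $D$) the supplier knows $\alpha$ and charges $\alpha/2$. The demand is nonnegative with continuous (non-atomic) cdf $F$, $F(0)=0$, and finite mean; $\bar F:=1-F$, $S$ is the support of $F$, $L=\sup\{r\ge0:F(r)=0\}$, $H=\inf\{r\ge0:F(r)=1\}\in(0,\infty]$. The mean residual demand function is $\mathrm{m}(r):=\frac{1}{\bar F(r)}\int_r^\infty\bar F(u)\,du$ for $r<H$, $\mathrm{m}(r):=0$ otherwise. $F$ is strictly DGMRD if $\mathrm{m}(r)/r$ is strictly decreasing on $(0,H)$. If $F$ is strictly DGMRD with finite second moment, the supplier's optimal price in the stochastic market, i.e. the maximizer $r^*$ over $r\ge0$ of $r\int_r^\infty\bar F(u)\,du$, exists and is the unique solution of $r=\mathrm{m}(r)$. Realized equilibrium profits at demand level $\alpha$ are: stochastic market: $\Pi_s^U=\frac{n}{n+1}r^*(\alpha-r^* )_+$ (supplier), $\Pi_i^U=\frac{1}{(n+1)^2}(\alpha-r^* )_+^2$ (retailer $i$), $\Pi^U_{\mathrm{Agg}}=\Pi_s^U+\sum_{i=1}^n\Pi_i^U$ (aggregate); deterministic market: $\Pi_s^D=\frac{n}{n+1}(\alpha/2)^2$,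 $\Pi_i^D=\frac{1}{(n+1)^2}(\alpha/2)^2$, $\Pi^D_{\mathrm{Agg}}=\Pi_s^D+\sum_{i=1}^n\Pi_i^D$. *)

(* Defs.v *)
From mathcomp Require Import all_boot all_order all_algebra.
From mathcomp Require Import all_classical all_reals all_analysis.
Import Order.TTheory GRing.Theory Num.Theory.
Import numFieldNormedType.Exports.

Set Implicit Arguments.
Unset Strict Implicit.
Unset Printing Implicit Defensive.

Local Open Scope classical_set_scope.
Local Open Scope ring_scope.

(* The demand level is a real random variable X with law F; [cdf X] is F and
   [ccdf X] is 1 - F (lemma [ccdf_1_cdf]), both valued in the extended reals. *)
Section Demand.
Context {d : measure_display} {T : measurableType d} {R : realType}.
Context {P : probability T R}.
Implicit Types (X : {RV P >-> R}) (r : R).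

Definition demand_support X : set R :=
  [set x | forall U : set R, open U -> U x -> (0 < distribution P X U)%E].

Definition demand_inf X : \bar R :=
  ereal_sup [set r%:E | r in [set r : R | 0 <= r /\ cdf X r = 0%E]].

(* The infimum of the empty set is +oo. *)
Definition demand_sup X : \bar R :=
  ereal_inf [set r%:E | r in [set r : R | 0 <= r /\ cdf X r = 1%E]].

Definition demand_distribution X : Prop :=
  [/\ {ae P, forall t, 0 <= X t},
      continuous (cdf X),
      cdf X 0 = 0%E &
      P.-integrable [set: T] (EFin \o X)].

Definition finite_second_moment X : Prop :=
  ('E_P[fun t => (X t ^+ 2)%R] < +oo)%E.

Definition tail_integral X r : \bar R :=
  (\int[lebesgue_measure]_(u in `[r, +oo[) ccdf X u)%E.

Definition mean_residual_demand X r : R :=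
  if (r%:E < demand_sup X)%E
  then fine (tail_integral X r) / fine (ccdf X r)
  else 0.

Definition strictly_DGMRD X : Prop :=
  forall r s : R, 0 < r -> r < s -> (s%:E < demand_sup X)%E ->
    mean_residual_demand X s / s < mean_residual_demand X r / r.

(* The supplier's expected profit, up to the positive factor n / (n + 1). *)
Definition supplier_objective X r : \bar R := (r%:E * tail_integral X r)%E.

Definition optimal_price X (rstar : R) : Prop :=
  0 <= rstar /\
  forall r, 0 <= r -> (supplier_objective X r <= supplier_objective X rstar)%E.

(* Demand levels that can be realized and at which retailers order in the
   stochastic market; they also order in the deterministic one since
   [alpha / 2 < alpha] for [0 <= rstar < alpha]. *)
Definition trade_levels X (rstar : R) : set R :=
  [set alpha | demand_support X alpha /\ rstar < alpha].

End Demand.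

(* Realized equilibrium profits with n retailers at demand level alpha; suffix
   U: stochastic market with wholesale price r, suffix D: deterministic market. *)
Section Profits.
Context {R : realType}.
Implicit Types (n : nat) (r alpha : R).

Definition pos_part (x : R) : R := Num.max 0 x.

Definition supplier_profitU n r alpha : R :=
  n%:R / n.+1%:R * r * pos_part (alpha - r).

Definition retailer_profitU n r alpha : R :=
  1 / n.+1%:R ^+ 2 * pos_part (alpha - r) ^+ 2.

Definition aggregate_profitU n r alpha : R :=
  supplier_profitU n r alpha + \sum_(i < n) retailer_profitU n r alpha.

Definition supplier_profitD n alpha : R :=
  n%:R / n.+1%:R * (alpha / 2) ^+ 2.

Definition retailer_profitD n alpha : R :=
  1 / n.+1%:R ^+ 2 * (alpha / 2) ^+ 2.

Definition aggregate_profitD n alpha : R :=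
  supplier_profitD n alpha + \sum_(i < n) retailer_profitD n alpha.

Definition supplier_shareU n r alpha : R :=
  supplier_profitU n r alpha / aggregate_profitU n r alpha.

Definition supplier_shareD n alpha : R :=
  supplier_profitD n alpha / aggregate_profitD n alpha.

End Profits.

(* Main.v *)
Require Import Defs.
From mathcomp Require Import all_boot all_order all_algebra.
From mathcomp Require Import all_classical all_reals all_analysis.
From mathcomp Require Import measurable_realfun ring lra.
Import Order.TTheory GRing.Theory Num.Theory.
Import numFieldNormedType.Exports.
Local Open Scope classical_set_scope.
Local Open Scope ring_scope.

Set Implicit Arguments.
Unset Strict Implicit.
Unset Printing Implicit Defensive.

(** The optimal wholesale price [r] is positive, since [0] earns nothing while any
    price in [(0, H)] has a positive expected profit.  Everything else is algebra:
    the two supplier profits differ by a positive multiple of [(alpha / 2 - r)^2],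
    and for [alpha > r] the supplier's shares simplify to
    [(n + 1) r / ((n + 1) r + (alpha - r))] and [(n + 1) / (n + 2)]. *)

(** Otherwise the cdf is 1 at [s], so [s] lies in the set whose infimum is [demand_sup X];
    membership in that set also requires [0 <= s]. *)
Lemma ccdf_gt0 (R : realType) (d : measure_display) (T : measurableType d)
    (P : probability T R) (X : {RV P >-> R}) (s : R) :
  0 <= s -> (s%:E < demand_sup X)%E -> (0 < ccdf X s)%E.
Proof.
move=> s0 sH; rewrite lt0e measure_ge0 andbT; apply/eqP => ccdf0.
have cdf1 : cdf X s = 1%E by rewrite cdf_1_ccdf ccdf0 sube0.
by move: sH; rewrite ltNge => /negP; apply; apply: ereal_inf_lbound; exists s.
Qed.

(** Since [ccdf X] is nonincreasing, the integral over [[r, s]] alone is at least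
    [(s - r) * ccdf X s]. *)
Lemma tail_integral_gt0 (R : realType) (d : measure_display)
    (T : measurableType d) (P : probability T R) (X : {RV P >-> R}) (r s : R) :
  0 <= s -> r < s -> (s%:E < demand_sup X)%E -> (0 < tail_integral X r)%E.
Proof.
move=> s0 rs sH; have ccdf_s := ccdf_gt0 s0 sH.
apply: (@lt_le_trans _ _ (\int[lebesgue_measure]_(u in `[r, s]) ccdf X s)%E).
  rewrite integral_cst //= lebesgue_measure_itv /= lte_fin rs -EFinB.
  by apply: mule_gt0 => //; rewrite lte_fin subr_gt0.
apply: (@le_trans _ _ (\int[lebesgue_measure]_(u in `[r, s]) ccdf X u)%E).
  apply: ge0_le_integral => //.
  - by apply: measurable_funTS; exact: ccdf_measurable.
  - by move=> u /=; rewrite in_itv /= => /andP[_ us]; exact: ccdf_nonincreasing.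
apply: ge0_subset_integral => //.
- by apply: measurable_funTS; exact: ccdf_measurable.
- by move=> u /=; rewrite !in_itv /= => /andP[->].
Qed.

Lemma optimal_price_gt0 (R : realType) (d : measure_display)
    (T : measurableType d) (P : probability T R) (X : {RV P >-> R}) (r : R) :
  (0 < demand_sup X)%E -> optimal_price X r -> 0 < r.
Proof.
move=> H0 [r0 r_max]; rewrite lt_neqAle r0 andbT; apply/eqP => r_eq0.
(* [demand_sup X] may be [+oo], in which case any positive price serves. *)
have [s s0 sH] : exists2 s : R, 0 < s & (s%:E < demand_sup X)%E.
  case: (demand_sup X) H0 => [h| |//]; last by exists 1 => //; exact: ltry.
  by rewrite lte_fin => h0; exists (h / 2); rewrite ?lte_fin; lra.
(* The competing price is [s / 2] rather than [s], so that [[s / 2, s]] has positive length. *)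
have half_s : 0 < s / 2 by lra.
have := r_max _ (ltW half_s); rewrite /supplier_objective -r_eq0 mul0e leNgt.
move/negP; apply; apply: mule_gt0; first by rewrite lte_fin.
by apply: (tail_integral_gt0 (ltW s0)) => //; lra.
Qed.

Section RealizedProfits.
Context {R : realType}.
Implicit Types (n : nat) (r alpha : R).

Lemma pos_part_ge0 (x : R) : 0 <= x -> pos_part x = x.
Proof. exact: max_r. Qed.

(** The price [alpha / 2] maximizes the quadratic [p * (alpha - p)]; completing the square gives the
    loss incurred at [p = r]. *)
Lemma supplier_profitDB n r alpha : r <= alpha ->
  supplier_profitD n alpha - supplier_profitU n r alpha =
  n%:R / n.+1%:R * (alpha / 2 - r) ^+ 2.
Proof.
move=> ra; rewrite /supplier_profitD /supplier_profitU pos_part_ge0; last by lra.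
by field; rewrite nat1r pnatr_eq0.
Qed.

Lemma supplier_profitU_le n r alpha : r <= alpha ->
  supplier_profitU n r alpha <= supplier_profitD n alpha.
Proof.
move=> ra; rewrite -subr_ge0 supplier_profitDB //.
by rewrite mulr_ge0 ?sqr_ge0 ?divr_ge0.
Qed.

Lemma supplier_profitU_eq n r alpha : (0 < n)%N -> r <= alpha ->
  supplier_profitU n r alpha = supplier_profitD n alpha <-> alpha = 2 * r.
Proof.
move=> n0 ra; split=> [/esym/eqP|alphaE]; last first.
  apply/esym/subr0_eq; rewrite supplier_profitDB // alphaE.
  by field; rewrite nat1r pnatr_eq0.
(* As [n > 0], the factor [n / (n + 1)] is nonzero, so the square must vanish. *)
rewrite -subr_eq0 supplier_profitDB // !mulf_eq0 invr_eq0 !pnatr_eq0 orbb.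
by rewrite eqn0Ngt n0 /= => /eqP; lra.
Qed.

Lemma supplier_profit_ratio n r alpha : (0 < n)%N -> 0 < alpha -> r <= alpha ->
  supplier_profitU n r alpha / supplier_profitD n alpha =
  4 * (r / alpha) * (1 - r / alpha).
Proof.
move=> n0 a0 ra.
rewrite /supplier_profitU /supplier_profitD pos_part_ge0; last by lra.
by field; rewrite nat1r !pnatr_eq0 gt_eqF //= -lt0n.
Qed.

(* The wholesale price [p] and the quantity factor [y] are [r] and [alpha - r] in
   the stochastic market, and both [alpha / 2] in the deterministic one. *)
Lemma supplier_shareE n (p y : R) : (0 < n)%N -> 0 < p -> 0 < y ->
  let profit := n%:R / n.+1%:R * p * y in
  profit / (profit + \sum_(i < n) 1 / n.+1%:R ^+ 2 * y ^+ 2) =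
  n.+1%:R * p / (n.+1%:R * p + y).
Proof.
move=> n0 p0 y0 /=; rewrite sumr_const card_ord -[(_ * _) *+ n]mulr_natl.
have : 0 < n%:R :> R by rewrite ltr0n.
have : 0 < n.+1%:R :> R by [].
(* The identity holds for any positive [N] and [k], so the relation [N = k + 1] can be forgotten. *)
move: n.+1%:R n%:R => N k N0 k0; have Np0 := mulr_gt0 N0 p0.
have Npy0 : N * p + y != 0 by rewrite gt_eqF // addr_gt0.
field; rewrite Npy0 gt_eqF //=.
(* This is the denominator that [field] requires to be nonzero; factoring exhibits its
   positivity. *)
have -> : k * p * y * N + k * y ^+ 2 = k * y * (N * p + y) by ring.
by rewrite !mulf_neq0 ?gt_eqF // addr_gt0.
Qed.

Lemma supplier_shareUE n r alpha : (0 < n)%N -> 0 < r -> r < alpha ->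
  supplier_shareU n r alpha = n.+1%:R * r / (n.+1%:R * r + (alpha - r)).
Proof.
move=> n0 r0 ra; have ar : 0 < alpha - r by rewrite subr_gt0.
rewrite -(supplier_shareE n0 r0 ar) /supplier_shareU /aggregate_profitU.
by rewrite /supplier_profitU /retailer_profitU (pos_part_ge0 (ltW ar)).
Qed.

Lemma supplier_shareDE n alpha : (0 < n)%N -> 0 < alpha ->
  supplier_shareD n alpha = n.+1%:R / (n.+1%:R + 1).
Proof.
move=> n0 a0; have h0 : 0 < alpha / 2 by lra.
have N0 : 0 < n.+1%:R :> R by [].
rewrite /supplier_shareD /aggregate_profitD /supplier_profitD /retailer_profitD.
have -> : n%:R / n.+1%:R * (alpha / 2) ^+ 2 =
    n%:R / n.+1%:R * (alpha / 2) * (alpha / 2) by rewrite -[RHS]mulrA expr2.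
rewrite (supplier_shareE n0 h0 h0) -[X in _ / (_ + X)]mul1r -mulrDl -mulf_div.
by rewrite divff ?mulr1 // gt_eqF.
Qed.

(** Cross-multiplying, the common term [a * a'] cancels. Every strict comparison of shares below
    reduces to this form. *)
Lemma ltr_share (a b a' b' : R) : 0 < a -> 0 < b -> 0 < a' -> 0 < b' ->
  (a / (a + b) < a' / (a' + b')) = (a * b' < a' * b).
Proof.
move=> a0 b0 a'0 b'0; rewrite ltr_pdivrMr ?addr_gt0 // mulrAC.
by rewrite ltr_pdivlMr ?addr_gt0 // !mulrDr (mulrC a' a) ltrD2l.
Qed.

(** A difference of the squares of [alpha - r] and [alpha / 2], factored. *)
Lemma retailer_profitB n r alpha : r <= alpha ->
  retailer_profitU n r alpha - retailer_profitD n alpha =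
  1 / n.+1%:R ^+ 2 * (3 / 2 * alpha - r) * (alpha / 2 - r).
Proof.
move=> ra; rewrite /retailer_profitU /retailer_profitD pos_part_ge0; last by lra.
by field; rewrite nat1r pnatr_eq0.
Qed.

(** For [0 < r < alpha] the factor [3 / 2 * alpha - r] is positive. Stating the result with signs
    covers [<], [=] and [>] at once. *)
Lemma retailer_profit_sg n r alpha : 0 < r -> r < alpha ->
  Num.sg (retailer_profitU n r alpha - retailer_profitD n alpha) =
  Num.sg (alpha - 2 * r).
Proof.
move=> r0 ra; rewrite retailer_profitB; last exact: ltW.
have -> : alpha / 2 - r = 2^-1 * (alpha - 2 * r) by field.
by rewrite mulrA sgrM gtr0_sg ?mul1r // !mulr_gt0 //; last by lra.
Qed.

End RealizedProfits.

Theorem theorem5p5 (R : realType) (d : measure_display) (T : measurableType d)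
    (P : probability T R) (X : {RV P >-> R}) (rstar : R)
    (X_demand : demand_distribution X)
    (X_support : forall x : R, demand_support X x ->
       (demand_inf X <= x%:E)%E /\ (x%:E <= demand_sup X)%E)
    (X_DGMRD : strictly_DGMRD X)
    (X_moment2 : finite_second_moment X)
    (rstar_opt : optimal_price X rstar)
    (rstar_H : ((2 * rstar)%:E < demand_sup X)%E) :
  (* (i) *)
  (forall (n : nat) (alpha : R), (1 <= n)%N -> trade_levels X rstar alpha ->
     supplier_profitU n rstar alpha <= supplier_profitD n alpha /\
     (supplier_profitU n rstar alpha = supplier_profitD n alpha <->
      alpha = 2 * rstar)) /\
  (forall (n : nat) (alpha : R), (1 <= n)%N -> rstar < alpha ->
     supplier_profitU n rstar alpha / supplier_profitD n alpha =
     4 * (rstar / alpha) * (1 - rstar / alpha)) /\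
  (* (ii) *)
  (forall (n : nat) (alpha beta : R), (1 <= n)%N ->
     trade_levels X rstar alpha -> trade_levels X rstar beta ->
     alpha < beta ->
     supplier_shareU n rstar beta < supplier_shareU n rstar alpha) /\
  (* (iii) *)
  (forall (n : nat) (alpha beta : R), (1 <= n)%N ->
     trade_levels X rstar alpha -> trade_levels X rstar beta ->
     supplier_shareD n alpha = supplier_shareD n beta) /\
  (* (iv) *)
  (forall (n : nat) (alpha : R), (1 <= n)%N -> trade_levels X rstar alpha ->
     (alpha < 2 * rstar ->
      supplier_shareD n alpha < supplier_shareU n rstar alpha) /\
     (alpha = 2 * rstar ->
      supplier_shareU n rstar alpha = supplier_shareD n alpha) /\
     (2 * rstar < alpha ->
      supplier_shareU n rstar alpha < supplier_shareD n alpha)) /\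
  (* (v) *)
  (forall (m n : nat) (alpha : R), (1 <= m)%N -> (m < n)%N ->
     trade_levels X rstar alpha ->
     supplier_shareD m alpha < supplier_shareD n alpha /\
     supplier_shareU m rstar alpha < supplier_shareU n rstar alpha) /\
  (* retailers' profits *)
  (forall (n : nat) (alpha : R), (1 <= n)%N -> trade_levels X rstar alpha ->
     (2 * rstar < alpha ->
      retailer_profitD n alpha < retailer_profitU n rstar alpha) /\
     (alpha < 2 * rstar ->
      retailer_profitU n rstar alpha < retailer_profitD n alpha) /\
     (retailer_profitU n rstar alpha = retailer_profitD n alpha <->
      alpha = 2 * rstar)).
Proof.
have [r_ge0 _] := rstar_opt.
have r0 : 0 < rstar.
  (* [0 <= 2 * rstar < demand_sup X] makes [demand_sup X] positive. *)
  apply: optimal_price_gt0 rstar_opt; apply: le_lt_trans rstar_H.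
  by rewrite lee_fin mulr_ge0.
have a0 alpha : rstar < alpha -> 0 < alpha by exact: lt_trans.
have Nr0 n : 0 < n.+1%:R * rstar by rewrite mulr_gt0.
(* Scaling by [rstar] gives the stochastic share with [alpha - rstar] replaced by [rstar], ready for
   [ltr_share]. *)
have shareDE n alpha : (1 <= n)%N -> rstar < alpha ->
    supplier_shareD n alpha = n.+1%:R * rstar / (n.+1%:R * rstar + rstar).
  move=> n1 ra; rewrite supplier_shareDE ?a0 //.
  by rewrite -[X in _ = _ / (_ + X)]mul1r -mulrDl -mulf_div divff ?mulr1 ?gt_eqF.
have ar alpha : rstar < alpha -> 0 < alpha - rstar by rewrite subr_gt0.
split; [|split; [|split; [|split; [|split; [|split]]]]].
- move=> n alpha n1 [_ /ltW ra].
  by split; [exact: supplier_profitU_le|exact: supplier_profitU_eq].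
- by move=> n alpha n1 ra; apply: supplier_profit_ratio; rewrite ?a0 ?ltW.
- move=> n alpha beta n1 [_ ra] [_ rb] ab.
  rewrite !supplier_shareUE // ltr_share ?ar // ltr_pM2l //; lra.
- by move=> n alpha beta n1 [_ ra] [_ rb]; rewrite !shareDE.
(* The numerators agree, so only [alpha - rstar] and [rstar] are compared. *)
- move=> n alpha n1 [_ ra]; rewrite supplier_shareUE // shareDE //; split=> [aH|].
    by rewrite ltr_share ?ar // ltr_pM2l //; lra.
  split=> aH; last by rewrite ltr_share ?ar // ltr_pM2l //; lra.
  by have -> : alpha - rstar = rstar by lra.
- move=> m n alpha m1 mn [_ ra]; have n1 : (0 < n)%N := leq_trans m1 (ltnW mn).
  (* In both markets the second term of the denominator is free of the number of retailers, so this
     inequality decides both claims. *)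
  have Nmn : m.+1%:R * rstar < n.+1%:R * rstar by rewrite ltr_pM2r // ltr_nat.
  rewrite !shareDE // !supplier_shareUE // !ltr_share ?ar //.
  by split; rewrite ltr_pM2r ?ar.
- move=> n alpha n1 [_ ra]; have sgE := retailer_profit_sg n r0 ra.
  split=> [aH|]; last split=> [aH|].
  + by rewrite -subr_gt0 -sgr_gt0 sgE sgr_gt0 subr_gt0.
  + by rewrite -subr_lt0 -sgr_lt0 sgE sgr_lt0 subr_lt0.
  + split=> [/eqP|/eqP]; rewrite -subr_eq0 -sgr_eq0.
      by rewrite sgE sgr_eq0 subr_eq0 => /eqP.
    by rewrite -sgE sgr_eq0 subr_eq0 => /eqP.
Qed.
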